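(* Let $Q$ be an even positive-definite quadratic form of level two in $v$ variables. If $8 \mid v$, then there exist a positive integer $n$ with $2n \le 2 + \frac v4$ and $\mathbf{x} \in \mathbb{Z}^v$ with $Q(\mathbf{x}) = 2n$. If $v \equiv 4 \pmod 8$, then there exist a positive integer $n$ with $2n \le 1 + \frac v4$ and $\mathbf{x} \in \mathbb{Z}^v$ with $Q(\mathbf{x}) = 2n$.
   Context: For even $v$, let $A$ be a $v\times v$ symmetric matrix with integer entries, even diagonal entries, and positive eigenvalues; the associated even positive-definite quadratic form is $Q_A(\mathbf{x}) = {}^t\mathbf{x} A \mathbf{x}$ for column vectors $\mathbf{x} \in \mathbb{Z}^v$. The level of $Q_A$ is the smallest positive integer $N$ such that $N A^{-1}$ has integer entries and even diagonal entries. (For a level two form, $v$ is necessarily divisible by 4.) *)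

(* Defs.v *)
From mathcomp Require Import all_boot all_order all_algebra all_field.
Set Implicit Arguments. Unset Strict Implicit. Unset Printing Implicit Defensive.
Import Order.TTheory GRing.Theory Num.Theory.
Local Open Scope ring_scope.

Definition mx_rat (v : nat) (A : 'M[int]_v) : 'M[rat]_v := map_mx (fun z => z%:~R) A.
Definition mx_algC (v : nat) (A : 'M[int]_v) : 'M[algC]_v := map_mx (fun z => z%:~R) A.

Definition int_even_diag (v : nat) (B : 'M[rat]_v) : Prop :=
  (forall i j, B i j \is a Num.int) /\ (forall i, exists k : int, B i i = (2 * k)%:~R).

Definition even_pos_def_form (v : nat) (A : 'M[int]_v) : Prop :=
  A^T = A /\ (forall i, (2 %| A i i)%Z) /\
  (forall a : algC, eigenvalue (mx_algC A) a -> 0 < a).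

Definition QA (v : nat) (A : 'M[int]_v) (x : 'cV[int]_v) : int := (x^T *m A *m x) 0 0.

Definition is_level (v : nat) (A : 'M[int]_v) (N : nat) : Prop :=
  (0 < N)%N /\ int_even_diag (N%:R *: invmx (mx_rat A)) /\
  (forall M : nat, (0 < M)%N -> (M < N)%N -> ~ int_even_diag (M%:R *: invmx (mx_rat A))).

(* Main.v *)
Require Import Defs.
From mathcomp Require Import all_boot all_order all_algebra all_field spectral.
From mathcomp Require Import all_classical all_reals all_analysis.
From mathcomp Require Import Rstruct ring lra zify.
Set Implicit Arguments. Unset Strict Implicit. Unset Printing Implicit Defensive.
Import Order.TTheory GRing.Theory Num.Theory.
Import numFieldNormedType.Exports.
Local Open Scope ring_scope.

(** No modular forms are needed: the bound already follows from Blichfeldt's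
    sphere packing estimate. Write v = 2k and let mu be the minimum of Q_A on
    nonzero integer vectors. At any point, the caps (1 - 2 Q_A(. - z) / mu)_+
    centred at the lattice points z sum to at most 1, so the integral of one cap
    is at most 1, that is (pi mu / 4)^k <= (k+1)! (sqrt (det A) / 2^k). Level two
    makes 2 A^-1 integral, hence det A <= 2^v and (pi mu / 4)^k <= (k+1)!, which
    fails as soon as mu / 4 >= (k + 6) / 8. The integral is replaced by
    sums over (1/M) Z^v with M tending to infinity; these are bounded below one
    coordinate at a time, each coordinate (split off by a Schur complement)
    contributing the Wallis integral of a power of the cosine. *)

(** * Wallis integrals and one-dimensional sums *)

Section Wallis.
Variable R : realType.
Implicit Types (t x y h : R) (m p : nat).

(** The reduction formula for the antiderivative of [cos ^ m], taken as a definition: Wallis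
    integrals become differences of two explicit values. *)
Fixpoint cos_primitive m t : R :=
  match m with
  | 0 => t
  | 1 => sin t
  | m'.+2 =>
    (m'.+2)%:R^-1 * (sin t * cos t ^+ m'.+1 + m'.+1%:R * cos_primitive m' t)
  end.

Lemma is_derive_cos_primitive m t :
  is_derive t 1 (cos_primitive m) (cos t ^+ m).
Proof.
have [k] := ubnP m; elim: k m => // k IH [|[|m]] ltm.
- by rewrite expr0 /=; exact: is_derive_id.
- by rewrite expr1 /=; exact: is_derive_sin.
have {}IH : is_derive t 1 (cos_primitive m) (cos t ^+ m).
  by apply: IH; rewrite ltnS in ltm; exact: leq_trans ltm.
have -> : cos_primitive m.+2 = (m.+2)%:R^-1 *: (sin * cos ^+ m.+1 +
     m.+1%:R *: cos_primitive m).
  by apply/funext => u /=; rewrite !fctE /GRing.scale /=.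
have DX := is_deriveX m.+1 (is_derive_cos t).
have DM := is_deriveM (is_derive_sin t) DX.
have D := is_deriveZ m.+2%:R^-1 (is_deriveD DM (is_deriveZ m.+1%:R IH)).
apply: (is_derive_eq D); rewrite /GRing.scale /=.
rewrite exprfctE.
have -> : sin t * (m.+1%:R * cos t ^+ m * - sin t) =
   - m.+1%:R * cos t ^+ m * (sin t ^+ 2) by ring.
rewrite sin2cos2 !exprS -[m.+2]addn1 natrD.
have : (m.+1%:R + 1 : R) != 0 by rewrite natr1 pnatr_eq0.
by move=> ?; field.
Qed.

Definition wallis m : R := cos_primitive m (pi / 2) - cos_primitive m (- (pi / 2)).

Lemma wallis0 : wallis 0 = pi. Proof. by rewrite /wallis /= opprK -splitr. Qed.

Lemma wallis1 : wallis 1 = 2.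
Proof. by rewrite /wallis /= sinN sin_pihalf opprK. Qed.

Lemma wallisSS m : wallis m.+2 = m.+1%:R / m.+2%:R * wallis m.
Proof.
rewrite /wallis /= cosN cos_pihalf expr0n /= !mulr0 !add0r.
by rewrite -mulrBr -mulrBr mulrA [_^-1 * _]mulrC.
Qed.

Lemma wallis_gt0 m : 0 < wallis m.
Proof.
suff : 0 < wallis m /\ 0 < wallis m.+1 by case.
elim: m => [|m [h0 h1]]; first by rewrite wallis0 wallis1 pi_gt0.
by split=> //; rewrite wallisSS !mulr_gt0 // invr_gt0 ltr0n.
Qed.

(** By the recursion, [(m + 1) W_m W_(m+1)] does not depend on [m]. *)
Lemma wallisM m : wallis m * wallis m.+1 = 2 * pi / m.+1%:R.
Proof.
elim: m => [|m IH]; first by rewrite wallis0 wallis1 divr1 mulrC.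
rewrite wallisSS mulrCA [wallis m.+1 * _]mulrC IH.
have h1 : (m.+1%:R : R) != 0 by rewrite pnatr_eq0.
have h2 : (m.+2%:R : R) != 0 by rewrite pnatr_eq0.
by move: h1 h2; move: (m.+1%:R : R) (m.+2%:R : R) => a b a0 b0; field; rewrite ?a0 ?b0.
Qed.

(** Neighbouring factors pair up to [pi / (j + 2)]. The value is the integral of [1 - |x|^2] over
    the unit ball of dimension [2n]. *)
Lemma prod_wallis n :
  \prod_(i < n.*2) wallis (3 + i) = pi ^+ n / n.+1`!%:R.
Proof.
elim: n => [|n IH]; first by rewrite big_ord0 expr0 factS fact0 divr1.
rewrite doubleS !big_ord_recr /= IH -mulrA -!addSnnS wallisM !addSn add0n.
have -> : n.*2.+4%:R = 2 * n.+2%:R :> R by rewrite -natrM mul2n.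
rewrite [in RHS]factS natrM exprS.
have h1 : (n.+2%:R : R) != 0 by rewrite pnatr_eq0.
have h2 : (n.+1`!%:R : R) != 0 by rewrite pnatr_eq0 -lt0n fact_gt0.
move: h1 h2; move: (n.+2%:R : R) (n.+1`!%:R : R) => a b a0 b0; field; rewrite ?a0 ?b0.
by [].
Qed.

(* The derivative of [cos_primitive m.+1 - c * sin] is [cos * (cos ^+ m - c)]. *)
Lemma cos_primitive_le m (a b c : R) :
  - (pi / 2) <= a -> a <= b -> b <= pi / 2 ->
  (forall t, a <= t <= b -> cos t ^+ m <= c) ->
  cos_primitive m.+1 b - cos_primitive m.+1 a <= c * (sin b - sin a).
Proof.
move=> ha hab hb hc.
pose f := cos_primitive m.+1 - c *: sin.
have df t : is_derive t 1 f (cos t ^+ m.+1 - c * cos t).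
  exact: is_deriveB (is_derive_cos_primitive m.+1 t)
    (is_deriveZ c (is_derive_sin t)).
suff : f b <= f a by rewrite /f /= !fctE /GRing.scale /=; lra.
apply: (@ler0_derive1_le_cc R f a b) => //; rewrite ?in_itv /= ?lexx ?hab //.
- move=> u; rewrite in_itv /= => /andP[au ub].
  rewrite derive1E; have [_ ->] := df u.
  rewrite exprSr -mulrBl; apply: mulr_le0_ge0.
    by rewrite subr_le0; apply: hc; rewrite !ltW.
  by apply: cos_ge0_pihalf; rewrite (le_trans ha) ?(le_trans _ hb) ?ltW.
- apply: continuous_subspaceT => u.
  by apply: differentiable_continuous; apply/derivable1_diffP; have := df u; case.
Qed.

(* The cap profile [(1 - x^2)^(p/2)]; [Num.sqrt] makes it vanish off [-1, 1]. *)
Definition cap p x : R := Num.sqrt (1 - x ^+ 2) ^+ p.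

(** The substitution [x = sin t] turns the cap profile into [cos ^ (p + 1)]; clamping to [[-1, 1]]
    makes the primitive constant off the support. *)
Definition cap_primitive p x : R :=
  cos_primitive p.+1 (asin (Num.max (-1) (Num.min 1 x))).

Lemma cap_ge0 p x : 0 <= cap p x.
Proof. by rewrite /cap exprn_ge0 // sqrtr_ge0. Qed.

Lemma cap_le p x y : x ^+ 2 <= y ^+ 2 -> cap p y <= cap p x.
Proof.
move=> xy; rewrite /cap lerXn2r ?nnegrE ?sqrtr_ge0 //.
by rewrite ler_wsqrtr // lerB.
Qed.

Lemma cap_le1 p x : cap p x <= 1.
Proof.
apply: exprn_ile1; first exact: sqrtr_ge0.
have h : 1 - x ^+ 2 <= 1 by have := sqr_ge0 x; lra.
by have := ler_wsqrtr h; rewrite sqrtr1.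
Qed.

Lemma asin_ler x y : -1 <= x -> x <= y -> y <= 1 -> asin x <= asin y.
Proof.
move=> hx hxy hy.
have hX : -1 <= x <= 1 by rewrite hx (le_trans hxy).
have hY : -1 <= y <= 1 by rewrite hy (le_trans hx).
case: (leP (asin x) (asin y)) => // lt_yx.
have : sin (asin y) < sin (asin x).
  by rewrite ltr_sin // in_itv /= asin_geNpi2 // asin_lepi2.
by rewrite !asinK ?in_itv //= => /(le_lt_trans hxy); rewrite ltxx.
Qed.

Lemma cap_primitive_le p x y c : x <= y -> 0 <= c ->
  (forall u, -1 <= u <= 1 -> x <= u <= y -> cap p u <= c) ->
  cap_primitive p y - cap_primitive p x <= c * (y - x).
Proof.
move=> xy c0 hc; rewrite /cap_primitive.
set cl := fun x : R => Num.max (-1) (Num.min 1 x).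
rewrite -!/(cl _).
have clP u : [\/ u <= -1 /\ cl u = -1, -1 <= u <= 1 /\ cl u = u | 1 <= u /\ cl u = 1].
  rewrite /cl; case: (leP 1 u) => h1; first by apply: Or33; split=> //; apply: max_idPr; lra.
  case: (leP (-1) u) => h2; first by apply: Or32; split=> //=; exact: ltW.
  by apply: Or31; split=> //; exact: ltW.
have clB u : -1 <= cl u <= 1 by case: (clP u) => -[? ->] //; lra.
have clxy : cl x <= cl y by case: (clP x) => -[? ->]; case: (clP y) => -[? ->]; lra.
have clL : cl y - cl x <= y - x.
  by case: (clP x) => -[? ->]; case: (clP y) => -[? ->]; lra.
have [/andP[x1 x2] /andP[y1 y2]] := (clB x, clB y).
(* If both endpoints clamp to the same value, that point may lie outside [[x, y]], where nothing is
   known about [c] beyond its sign. *)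
have [eqc|nec] := eqVneq (cl x) (cl y).
  by rewrite eqc subrr mulr_ge0 // subr_ge0.
have clin u : cl x <= u <= cl y -> x <= u <= y.
  move: nec => /eqP nec /andP[u1 u2]; apply/andP; split.
    by case: (clP x) nec u1 => -[h ->]; case: (clP y) => -[h' ->]; lra.
  by case: (clP y) nec u2 => -[h ->]; case: (clP x) => -[h' ->]; lra.
apply: le_trans (_ : c * (cl y - cl x) <= _); last exact: ler_wpM2l.
have h := @cos_primitive_le p (asin (cl x)) (asin (cl y)) c.
rewrite !asinK ?in_itv ?clB //= in h.
apply: h.
- by rewrite asin_geNpi2 // clB.
- exact: asin_ler.
- by rewrite asin_lepi2 // clB.
move=> t /andP[t1 t2].
have tB : - (pi / 2) <= t <= pi / 2.
  by rewrite (le_trans _ t1) ?(le_trans t2) ?asin_lepi2 ?asin_geNpi2 ?clB.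
have -> : cos t = Num.sqrt (1 - sin t ^+ 2).
  by rewrite -cos2sin2 sqrtr_sqr ger0_norm // cos_ge0_pihalf.
have sB u : -1 <= u <= 1 -> - (pi / 2) <= asin u <= pi / 2.
  by move=> ?; rewrite asin_geNpi2 // asin_lepi2.
apply: hc; first by rewrite sin_geN1 sin_le1.
apply: clin; rewrite -[cl x]asinK ?in_itv //= -[cl y]asinK ?in_itv //=.
have sin_le u w : - (pi / 2) <= u <= pi / 2 -> - (pi / 2) <= w <= pi / 2 ->
   u <= w -> sin u <= sin w.
  move=> hu hw uw; rewrite leNgt ltr_sin ?in_itv //= -?leNgt //.
by rewrite !sin_le ?sB.
Qed.

Lemma cap_primitiveB p x y : x <= -1 -> 1 <= y ->
  cap_primitive p y - cap_primitive p x = wallis p.+1.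
Proof.
move=> hx hy; rewrite /cap_primitive /wallis.
have -> : Num.max (-1) (Num.min 1 x) = -1 :> R.
  by apply: max_idPl; rewrite ge_min hx orbT.
have -> : Num.max (-1) (Num.min 1 y) = 1 :> R.
  by rewrite (min_idPl hy); apply: max_idPr; lra.
have pi0 : - (pi / 2) <= pi / 2 :> R by have := pi_gt0 R; lra.
have := @sinK R (pi / 2); rewrite sin_pihalf => ->; last first.
  by rewrite in_itv /= pi0 lexx.
have := @sinK R (- (pi / 2)); rewrite sinN sin_pihalf => -> //.
by rewrite in_itv /= pi0 lexx.
Qed.

(* Left of the origin the primitive lags one step behind, since there the
   samples are right endpoints; the cell containing the origin is lost. *)
Lemma riemann_sum_cap p (h x0 : R) N :
  0 < h -> x0 <= -1 -> 1 <= x0 + N%:R * h ->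
  wallis p.+1 - h <= \sum_(k < N) h * cap p (x0 + k%:R * h).
Proof.
move=> h0 hx hN.
pose G := cap_primitive p.
have Gl x : x <= 0 -> G x - G (x - h) <= h * cap p x.
  move=> x_le0; rewrite mulrC [X in _ <= _ * X](_ : h = x - (x - h)); last by ring.
  apply: cap_primitive_le; first lra; first exact: cap_ge0.
  move=> u hu /andP[u1 u2]; apply: cap_le; nra.
have Gr x : 0 <= x -> G (x + h) - G x <= h * cap p x.
  move=> x_ge0; rewrite mulrC [X in _ <= _ * X](_ : h = (x + h) - x); last by ring.
  apply: cap_primitive_le; first lra; first exact: cap_ge0.
  move=> u hu /andP[u1 u2]; apply: cap_le; nra.
have G1 x : G (x + h) - G x <= h.
  rewrite -[X in _ <= X]mul1r [X in _ <= _ * X](_ : h = (x + h) - x); last by ring.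
  apply: cap_primitive_le; [lra|lra|].
  by move=> u _ _; exact: cap_le1.
have inv n : (x0 + n%:R * h <= h ->
     G (x0 + n%:R * h - h) - G x0 <= \sum_(k < n) h * cap p (x0 + k%:R * h)) /\
   (0 < x0 + n%:R * h ->
     G (x0 + n%:R * h) - G x0 - h <= \sum_(k < n) h * cap p (x0 + k%:R * h)).
  elim: n => [|n [IH1 IH2]].
    rewrite !mul0r !addr0 big_ord0; split=> H; last lra.
    have -> : G (x0 - h) = G x0.
      by have := @cap_primitiveB p (x0 - h) 1; have := @cap_primitiveB p x0 1; rewrite /G; lra.
    lra.
  have E : x0 + n.+1%:R * h = x0 + n%:R * h + h by rewrite -natr1; ring.
  rewrite E big_ord_recr /=; move: IH1 IH2; set S := \sum_(i < n) _.
  set X := x0 + n%:R * h => IH1 IH2.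
  have [[Gl' Gr'] G1'] := (Gl X, Gr X, G1 X).
  have P1 : X + h <= h -> G (X + h - h) - G x0 <= S + h * cap p X.
    move=> H; rewrite addrK; have {}Gl' := Gl' ltac:(lra); have {}IH1 := IH1 ltac:(lra).
    lra.
  split=> // H; case: (leP X 0) => X0.
    have {}P1 := P1 ltac:(lra); rewrite addrK in P1; lra.
  have {}IH2 := IH2 X0; have {}Gr' := Gr' ltac:(lra); lra.
have [_ H] := inv N.
have := H (lt_le_trans ltr01 hN).
have := @cap_primitiveB p x0 (x0 + N%:R * h) hx hN; rewrite /G; lra.
Qed.

End Wallis.

(** * Sums over a lattice *)

Section QuadraticForm.
Variable F : fieldType.

Definition qform n (A : 'M[F]_n) (x : 'cV[F]_n) : F := (x^T *m A *m x) 0 0.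

Definition schur n (A : 'M[F]_(1 + n)) : 'M[F]_n :=
  drsubmx A - (A 0 0)^-1 *: (dlsubmx A *m (dlsubmx A)^T).

Lemma schur_sym n (A : 'M[F]_(1 + n)) : A^T = A -> (schur A)^T = schur A.
Proof.
move=> symA; rewrite /schur linearB linearZ /= trmx_mul trmxK.
by rewrite trmx_drsub symA.
Qed.

Lemma sym_block n (A : 'M[F]_(1 + n)) : A^T = A ->
  A = block_mx (A 0 0)%:M (dlsubmx A)^T (dlsubmx A) (drsubmx A).
Proof.
move=> symA; rewrite -{1}[A]submxK trmx_dlsub symA; congr block_mx.
by rewrite [LHS]mx11_scalar !mxE lshift0.
Qed.

(** Completing the square in the first coordinate; the Schur complement is the form left over in the
    others. *)
Lemma qform_schur n (A : 'M[F]_(1 + n)) k y : A^T = A -> A 0 0 != 0 ->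
  qform A (col_mx k%:M y) =
    A 0 0 * (k + (A 0 0)^-1 * ((dlsubmx A)^T *m y) 0 0) ^+ 2 + qform (schur A) y.
Proof.
move=> symA a0; rewrite {1}/qform {1}(sym_block symA); set a := A 0 0 in a0 *.
rewrite tr_col_mx mul_row_block mul_row_col tr_scalar_mx.
rewrite -!scalar_mxM !mulmxDl /qform /schur -/a.
set b := dlsubmx A; set D := drsubmx A.
rewrite mulmxBr mulmxBl -scalemxAr -scalemxAl.
have [t bt] : exists t, b^T *m y = t%:M by exists ((b^T *m y) 0 0); exact: mx11_scalar.
have yb : y^T *m b = t%:M by rewrite -[LHS]trmxK trmx_mul trmxK bt tr_scalar_mx.
rewrite -[k%:M *m b^T *m y]mulmxA bt yb [y^T *m (b *m b^T)]mulmxA yb.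
rewrite -[t%:M *m b^T *m y]mulmxA bt.
rewrite -!scalar_mxM !mxE eqxx !mulr1n.
by field.
Qed.

Lemma det_schur n (A : 'M[F]_(1 + n)) : A^T = A -> A 0 0 != 0 ->
  \det A = A 0 0 * \det (schur A).
Proof.
move=> symA a0; rewrite {1}(sym_block symA); set a := A 0 0 in a0 *.
pose L := block_mx 1%:M 0 (a^-1 *: dlsubmx A) 1%:M : 'M[F]_(1 + n).
have -> : block_mx a%:M (dlsubmx A)^T (dlsubmx A) (drsubmx A) =
   L *m block_mx a%:M (dlsubmx A)^T 0 (schur A).
  rewrite mulmx_block !mul1mx !mul0mx !addr0 /schur -/a -scalemxAl.
  by rewrite mul_mx_scalar scalerA mulVf // scale1r -scalemxAl addrC subrK.
by rewrite det_mulmx det_lblock !det1 !mul1r det_ublock det_scalar1.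
Qed.

End QuadraticForm.

(** * Positive definite rational matrices *)

Definition posdef n (A : 'M[rat]_n) : Prop :=
  A^T = A /\ forall x, x != 0 -> 0 < qform A x.

Lemma posdef_corner n (A : 'M[rat]_(1 + n)) : posdef A -> 0 < A 0 0.
Proof.
move=> [_ /(_ (delta_mx 0 0))]; rewrite /qform trmx_delta.
rewrite -rowE -colE !mxE; apply.
by apply/eqP => /matrixP/(_ 0 0)/eqP; rewrite !mxE !eqxx oner_eq0.
Qed.

Lemma posdef_schur n (A : 'M[rat]_(1 + n)) : posdef A -> posdef (schur A).
Proof.
move=> pA; have a0 := posdef_corner pA; have [symA posA] := pA.
split=> [|y y0]; first exact: schur_sym.
(* The first coordinate [- t] annihilates the completed square. *)
set t := (A 0 0)^-1 * ((dlsubmx A)^T *m y) 0 0.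
have := posA (col_mx (- t)%:M y); rewrite qform_schur ?gt_eqF // -/t.
rewrite addNr expr0n mulr0 add0r; apply.
by apply: contraNneq y0 => /(congr1 dsubmx); rewrite col_mxKd linear0 => ->.
Qed.

Lemma posdef_det n (A : 'M[rat]_n) : posdef A -> 0 < \det A.
Proof.
elim: n A => [|n IH] A pA; first by rewrite det_mx00.
rewrite (@det_schur _ n) ?gt_eqF ?posdef_corner //; last by case: pA.
by rewrite mulr_gt0 ?posdef_corner // IH //; exact: posdef_schur.
Qed.

(** * Lower bound for cap sums over a lattice *)

Section LatticeSum.
Variable R : realType.

(** The cap profile in terms of the squared length [s]. Half-integral exponents are needed because
    summing out one coordinate raises the exponent of [1 - s] by one half. *)
Definition bump p (s : R) : R := Num.sqrt (1 - s) ^+ p.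

Lemma bump_eq0 p s : (0 < p)%N -> 1 <= s -> bump p s = 0.
Proof. by move=> p0 s1; rewrite /bump ler0_sqrtr ?subr_le0 // expr0n gtn_eqF. Qed.

(** Rescaling by [u = sqrt (1 - s)] reduces this to [riemann_sum_cap] with step [sqrt d * h / u].
    The discretization error is absorbed into a shift of the argument of [bump], a shape that
    survives induction on the dimension. *)
Lemma line_sum_bump p (d h s b : R) : (0 < p)%N -> 0 < d -> 0 < h -> 0 <= s ->
  exists2 ks : seq int, uniq ks &
    wallis R p.+1 / Num.sqrt d *
        bump p.+1 (s + h * (2 * Num.sqrt d / wallis R p.+1)) <=
    \sum_(k <- ks) h * bump p (s + d * (h * k%:~R + b) ^+ 2).
Proof.
move=> p0 d0 h0 s0; have W0 := wallis_gt0 R p.+1.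
set W := wallis R p.+1 in W0 *; set g := Num.sqrt d.
have g0 : 0 < g by rewrite sqrtr_gt0.
have gE : d = g ^+ 2 by rewrite sqr_sqrtr // ltW.
have [e eE] : exists e, e = h * g / W by eexists.
have e0 : 0 < e by rewrite eE divr_gt0 // mulr_gt0.
have -> : h * (2 * g / W) = 2 * e by rewrite eE; ring.
have [s1|s1] := leP 1 (s + 2 * e).
  exists [::] => //; rewrite big_nil bump_eq0 // mulr0 //.
set u := Num.sqrt (1 - s).
have u0 : 0 < u by rewrite sqrtr_gt0; lra.
have uE : u ^+ 2 = 1 - s by rewrite sqr_sqrtr //; lra.
have h'0 : 0 < g * h / u by rewrite divr_gt0 // mulr_gt0.
set h' := g * h / u in h'0 *.
pose b' := g * b / u.
have arch (x : R) : exists B : nat, x <= B%:R.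
  exists (Num.bound `|x|); apply: le_trans (ler_norm _) _.
  exact/ltW/archi_boundP.
(* [B] moves the first sample to the left of [-1], and [N] carries the samples beyond [1]. *)
have [B hB] := arch ((b' + 1) / h').
have [N hN] := arch ((1 - (b' - B%:R * h')) / h').
have := @riemann_sum_cap R p h' (b' - B%:R * h') N h'0.
rewrite ler_pdivrMr // in hB; rewrite ler_pdivrMr // in hN.
move=> /(_ ltac:(lra) ltac:(lra)) HR.
exists [seq (k%:Z - B%:Z) | k <- iota 0 N].
  by rewrite map_inj_uniq ?iota_uniq // => x y /addIr [].
rewrite big_map -[N]subn0 big_mkord.
have -> : \sum_(i < N) h * bump p (s + d * (h * (i%:Z - B%:Z)%:~R + b) ^+ 2) =
   u ^+ p.+1 / g * \sum_(k < N) h' * cap p (b' - B%:R * h' + k%:R * h').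
  rewrite mulr_sumr; apply: eq_bigr => k _.
  rewrite rmorphB /= -!pmulrn.
  have -> : bump p (s + d * (h * (k%:R - B%:R) + b) ^+ 2) =
     u ^+ p * cap p (b' - B%:R * h' + k%:R * h').
    rewrite /bump /cap -exprMn; congr (_ ^+ p).
    rewrite -[u in RHS]ger0_norm ?(ltW u0) // -sqrtr_sqr -sqrtrM ?sqr_ge0 //.
    congr Num.sqrt; rewrite opprD addrA -uE /b' /h' gE.
    by field; rewrite gt_eqF.
  by rewrite /h' exprS; field; rewrite !gt_eqF.
apply: le_trans (_ : u ^+ p.+1 / g * (W - h') <= _); last first.
  by rewrite ler_pM2l // divr_gt0 // exprn_gt0.
have -> : u ^+ p.+1 / g * (W - h') = W / g * (u ^+ p * (u - e)).
  by rewrite /h' eE exprS; field; rewrite !gt_eqF.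
rewrite ler_pM2l ?divr_gt0 //.
rewrite /bump; set w := Num.sqrt _.
have w0 : 0 <= w by exact: sqrtr_ge0.
have wE : w ^+ 2 = u ^+ 2 - 2 * e by rewrite sqr_sqrtr; lra.
have u1 : u <= 1 by nra.
have wu : w <= u by nra.
(* Since [u <= 1], the square of [u - e] is at least [u ^ 2 - 2 e]; this is why the shift is
   [2 e]. *)
have wue : w <= u - e.
  have ue : e <= u by nra.
  rewrite -(@ler_pXn2r _ 2) ?nnegrE ?subr_ge0 //; nra.
rewrite exprSr; apply: ler_pM => //; first exact: exprn_ge0.
by rewrite lerXn2r ?nnegrE // ltW.
Qed.

Definition intvec n (z : 'cV[int]_n) : 'cV[rat]_n := map_mx intr z.

(** Induction on the dimension: summing over the first coordinate leaves a [bump] of exponent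
    [p + 1] for the Schur complement, and the shifts add up. As [K] is independent of [h], the shift
    vanishes as the mesh tends to [0]. *)
Theorem lattice_sum_bump n (A : 'M[rat]_n) p : (0 < p)%N -> posdef A ->
  exists2 K : R, 0 <= K & forall h s : R, 0 < h -> 0 <= s ->
  exists2 Z : seq 'cV[int]_n, uniq Z &
    (\prod_(i < n) wallis R (p.+1 + i)) / Num.sqrt (ratr (\det A)) *
       bump (p + n) (s + h * K) <=
    \sum_(z <- Z) h ^+ n * bump p (s + h ^+ 2 * ratr (qform A (intvec z))).
Proof.
elim: n A p => [|n IH] A p p0 pA.
  exists 0 => // h s h0 s0; exists [:: 0] => //.
  rewrite big_ord0 det_mx00 rmorph1 sqrtr1 divr1 mul1r addn0 mulr0 addr0.
  rewrite big_seq1 expr0 mul1r /qform mxE big_ord0.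
  by rewrite rmorph0 mulr0 addr0.
have a0 := posdef_corner pA; have symA := pA.1.
have ra0 : 0 < ratr (A 0 0) :> R by rewrite ltr0q.
have [K2 K20 HK2] := IH (schur A) p.+1 isT (posdef_schur pA).
pose K1 := 2 * Num.sqrt (ratr (A 0 0)) / wallis R p.+1.
have K10 : 0 <= K1.
  by rewrite divr_ge0 ?mulr_ge0 ?sqrtr_ge0 // ltW // wallis_gt0.
exists (K1 + K2); first exact: addr_ge0.
move=> h s h0 s0.
have hK1 : 0 <= h * K1 by rewrite mulr_ge0 // ltW.
have [Z' uZ' HZ'] := HK2 h (s + h * K1) h0 (addr_ge0 s0 hK1).
have qS z : 0 <= h ^+ 2 * ratr (qform (schur A) (intvec z)) :> R.
  rewrite mulr_ge0 ?sqr_ge0 // ler0q.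
  have [->|z0] := eqVneq (intvec z) 0.
    by rewrite /qform mulmx0 mxE.
  exact/ltW/(posdef_schur pA).2.
have /choice [ks Hks] : forall z : 'cV[int]_n, exists ks : seq int, uniq ks /\
    wallis R p.+1 / Num.sqrt (ratr (A 0 0)) *
      bump p.+1 (s + h ^+ 2 * ratr (qform (schur A) (intvec z)) + h * K1) <=
    \sum_(k <- ks) h * bump p (s + h ^+ 2 * ratr (qform A (intvec (col_mx k%:M z)))).
  move=> z.
  have [ks uks Hks] := @line_sum_bump p (ratr (A 0 0)) h
    (s + h ^+ 2 * ratr (qform (schur A) (intvec z)))
    (h * ratr ((A 0 0)^-1 * ((@dlsubmx _ 1 n 1 n A)^T *m intvec z) 0 0))
    p0 ra0 h0 (addr_ge0 s0 (qS z)).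
  exists ks; split=> //; apply: le_trans Hks _.
  apply: ler_sum => k _; rewrite ler_pM2l //.
  rewrite le_eqVlt; apply/orP; left; apply/eqP; congr bump.
  rewrite /intvec map_col_mx map_scalar_mx /= qform_schur ?gt_eqF // -/(intvec z).
  rewrite !(rmorphD, rmorphM, rmorphXn) /= ratr_int; ring.
exists [seq col_mx k%:M z | z <- Z', k <- ks z].
  apply: allpairs_uniq_dep => // [z _|[z1 k1] [z2 k2] _ _ /= E].
    by case: (Hks z).
  have [/matrixP/(_ 0 0)] := @eq_col_mx _ 1 n 1 _ _ _ _ E.
  by rewrite !mxE !eqxx !mulr1n => -> ->.
rewrite big_allpairs_dep /=.
rewrite big_ord_recl addn0 (@det_schur _ n) ?gt_eqF // rmorphM sqrtrM ?(ltW ra0) //.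
rewrite mulrDr addrA addnS -addSn.
have -> : \prod_(i < n) wallis R (p.+1 + lift ord0 i) =
    \prod_(i < n) wallis R (p.+2 + i).
  by apply: eq_bigr => i _; rewrite -addSnnS.
rewrite invfM mulrACA -[leLHS]mulrA.
apply: le_trans (ler_wpM2l _ HZ') _.
  by rewrite divr_ge0 ?sqrtr_ge0 // ltW // wallis_gt0.
rewrite mulr_sumr; apply: ler_sum => z _.
have [_ H] := Hks z.
under [leRHS]eq_bigr do rewrite exprSr -mulrA.
rewrite -mulr_sumr mulrCA ler_wpM2l ?exprn_ge0 ?(ltW h0) //.
by rewrite addrAC.
Qed.

End LatticeSum.

(** * Blichfeldt's packing bound *)

Lemma qformZ (F : fieldType) n (A : 'M[F]_n) a x :
  qform A (a *: x) = a ^+ 2 * qform A x.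
Proof.
rewrite /qform; have -> : (a *: x)^T = a *: x^T by rewrite linearZ.
by rewrite -!scalemxAl -scalemxAr scalerA mxE expr2.
Qed.

(** The moment identity behind Blichfeldt's method: for positive definite [A] the subtracted term
    has a sign, so large mutual distances force large distances from the origin. *)
Lemma qform_sum (F : fieldType) n (A : 'M[F]_n) (S : seq 'cV[F]_n) : A^T = A ->
  \sum_(x <- S) \sum_(y <- S) qform A (x - y) =
  2 * (size S)%:R * \sum_(x <- S) qform A x - 2 * qform A (\sum_(x <- S) x).
Proof.
move=> symA; pose B (x y : 'cV[F]_n) := (x^T *m A *m y) 0 0.
have Bsym x y : B y x = B x y.
  by rewrite /B -[in LHS](trmxK (y^T *m A *m x)) mxE !trmx_mul symA trmxK mulmxA.
have qB x y : qform A (x - y) = qform A x + qform A y - 2 * B x y.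
  have -> : qform A (x - y) = B x x - B x y - B y x + B y y.
    have trB : (x - y)^T = x^T - y^T by rewrite linearB.
    by rewrite /qform /B trB mulmxBr !mulmxBl !mxE; ring.
  rewrite Bsym /qform -!/(B _ _); ring.
have Bsum : qform A (\sum_(x <- S) x) = \sum_(x <- S) \sum_(y <- S) B x y.
  have trS : (\sum_(x <- S) x)^T = \sum_(x <- S) x^T by rewrite linear_sum.
  rewrite /qform mulmx_sumr summxE exchange_big /=; apply: eq_bigr => y _.
  by rewrite trS !mulmx_suml summxE.
have const (c : F) : \sum_(x <- S) c = (size S)%:R * c.
  by rewrite big_const_seq count_predT iter_addr_0 mulr_natl.
rewrite (eq_bigr (fun x => (size S)%:R * qform A x + \sum_(y <- S) qform A y -
    2 * \sum_(y <- S) B x y)) => [|x _]; last first.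
  rewrite (eq_bigr (fun y => qform A x + qform A y - 2 * B x y)) => [|y _] //.
  by rewrite sumrB big_split /= const -mulr_sumr.
by rewrite sumrB big_split /= const -!mulr_sumr -Bsum; ring.
Qed.

(* Blichfeldt: caps of squared radius [m / 2] around points at mutual squared
   distance at least [m] have total height at most 1 at any point. *)
Lemma sum_cap_separated n (A : 'M[rat]_n) (S : seq 'cV[rat]_n) m :
  posdef A -> 0 < m -> uniq S ->
  (forall x y, x \in S -> y \in S -> x != y -> m <= qform A (x - y)) ->
  \sum_(x <- S) (1 - 2 / m * qform A x) <= 1.
Proof.
move=> [symA posA] m0 uS sepS.
case: S uS sepS => [|x0 S'] uS sepS; first by rewrite big_nil.
set S := x0 :: S' in uS sepS *.
have k0 : 0 < (size S)%:R :> rat by rewrite ltr0n.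
have k1 : 1 <= (size S)%:R :> rat by rewrite ler1n.
have := qform_sum S symA.
have q0 : 0 <= qform A (\sum_(x <- S) x).
  have [->|?] := eqVneq (\sum_(x <- S) x) 0; first by rewrite /qform mulmx0 mxE.
  exact/ltW/posA.
have : m * ((size S)%:R * ((size S)%:R - 1)) <= \sum_(x <- S) \sum_(y <- S) qform A (x - y).
  have -> : m * ((size S)%:R * ((size S)%:R - 1)) = \sum_(x <- S) m * ((size S)%:R - 1).
    by rewrite big_const_seq count_predT iter_addr_0 -[RHS]mulr_natl; ring.
  rewrite big_seq [leRHS]big_seq; apply: ler_sum => x xS.
  rewrite (bigD1_seq x) //= subrr.
  have -> : qform A 0 = 0 by rewrite /qform mulmx0 mxE.
  rewrite add0r.
  have -> : m * ((size S)%:R - 1) = \sum_(y <- S | y != x) m.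
    rewrite big_const_seq iter_addr_0 -[RHS]mulr_natl mulrC; congr (_ * _).
    have := count_predC (pred1 x) S; rewrite count_uniq_mem // xS add1n => <-.
    by rewrite -natr1 addrK.
  rewrite big_seq_cond [leRHS]big_seq_cond; apply: ler_sum => y /andP[yS yx].
  by apply: sepS; rewrite // eq_sym.
set Q := \sum_(x <- S) qform A x; set T := \sum_(x <- S) \sum_(y <- S) _ => h1 h2.
rewrite sumrB big_const_seq count_predT iter_addr_0 -mulr_sumr -/Q.
rewrite lerBlDl -lerBlDr.
have h3 : m * ((size S)%:R - 1) <= 2 * Q.
  rewrite -(ler_pM2l k0); lra.
by rewrite mulrAC ler_pdivlMr // mulrC.
Qed.

Section Packing.
Variable R : realType.

Lemma bump_two (s : R) : bump 2 s = if s < 1 then 1 - s else 0.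
Proof.
rewrite /bump; case: ltP => h; first by rewrite sqr_sqrtr // subr_ge0 ltW.
by rewrite ler0_sqrtr ?expr0n // subr_le0.
Qed.

(** The vectors split into [M ^ n] residue classes modulo [M]. Two members of one class differ by
    [M] times a lattice vector, so [sum_cap_separated] bounds each class by [1]. *)
Lemma lattice_sum_le n (A : 'M[rat]_n) (Z : seq 'cV[int]_n) (M : nat) :
  posdef A -> (0 < M)%N -> (forall z, z != 0 -> 2 <= qform A (intvec z)) ->
  uniq Z ->
  \sum_(z <- Z) bump 2 (M%:R^-1 ^+ 2 * ratr (qform A (intvec z)) : R) <= M%:R ^+ n.
Proof.
move=> pA; case: M => // M _ minA uZ; set N := M.+1.
have N0 : 0 < N%:R :> rat by rewrite ltr0n.
pose res (z : 'cV[int]_n) : {ffun 'I_n -> 'I_N} :=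
  [ffun i => inord `|(z i ord0 %% N%:Z)%Z|%N].
have resP z w : res z = res w -> exists u, z - w = N%:Z *: u.
  move=> /ffunP E.
  exists (\col_i ((z i ord0 - w i ord0) %/ N%:Z)%Z); apply/matrixP => i j.
  rewrite !mxE (ord1 j) mulrC divzK //.
  rewrite -eqz_mod_dvd; apply/eqP.
  have mod_lt (a : int) : (`|(a %% N%:Z)%Z| < N)%N.
    by rewrite -ltz_nat gez0_abs ?modz_ge0 // ltz_pmod.
  have := congr1 (@nat_of_ord _) (E i); rewrite !ffunE !inordK //.
  by move=> /(congr1 Posz); rewrite !gez0_abs ?modz_ge0.
rewrite (partition_big res xpredT) //=.
have -> : N%:R ^+ n = \sum_(j : {ffun 'I_n -> 'I_N}) 1 :> R.
  by rewrite sumr_const card_ffun !card_ord natrX.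
apply: ler_sum => j _.
(* Only points with a positive cap are kept: there the truncated [bump] agrees with the rational
   expression in [sum_cap_separated]. *)
pose S := [seq z <- Z | (res z == j) && (N%:R^-1 ^+ 2 * qform A (intvec z) < 1)].
have -> : \sum_(z <- Z | res z == j) bump 2 (N%:R^-1 ^+ 2 * ratr (qform A (intvec z)) : R) =
   ratr (\sum_(x <- map (@intvec n) S) (1 - 2 / (2 * N%:R ^+ 2) * qform A x)).
  rewrite big_map big_filter big_mkcondr rmorph_sum; apply: eq_bigr => z _.
  have -> : N%:R^-1 ^+ 2 * ratr (qform A (intvec z)) =
     ratr (N%:R^-1 ^+ 2 * qform A (intvec z)) :> R.
    by rewrite rmorphM rmorphXn /= fmorphV rmorph_nat.
  rewrite bump_two -(ltr_rat R) rmorph1; case: ifP => _; last by rewrite rmorph0.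
  rewrite [RHS]rmorphB rmorph1; congr (1 - ratr (_ * _)).
  by field; rewrite gt_eqF.
rewrite -[leRHS](rmorph1 (ratr : rat -> R)) ler_rat.
apply: sum_cap_separated => //.
- by rewrite mulr_gt0 // exprn_gt0.
- rewrite map_inj_uniq ?filter_uniq // => z w /matrixP E; apply/matrixP => a b.
  by have := E a b; rewrite !mxE => /intr_inj.
move=> _ _ /mapP[z + ->] /mapP[w + ->].
rewrite !mem_filter => /andP[/andP[/eqP rz _] _] /andP[/andP[/eqP rw _] _] zw.
have [u E] : exists u, z - w = N%:Z *: u by apply: resP; rewrite rz rw.
have -> : intvec z - intvec w = N%:R *: intvec u.
  rewrite /intvec -map_mxB E; apply/matrixP => a b.
  by rewrite !mxE /= intrM -pmulrn.
rewrite qformZ mulrC ler_pM2l ?exprn_gt0 // minA //.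
apply: contraNneq zw => u0; move: E; rewrite u0 scaler0 => /eqP.
by rewrite subr_eq0 => /eqP ->.
Qed.

Theorem blichfeldt n k (A : 'M[rat]_n) : n = k.*2 -> posdef A ->
  (forall z, z != 0 -> 2 <= qform A (intvec z)) ->
  pi ^+ k <= k.+1`!%:R * Num.sqrt (ratr (\det A)) :> R.
Proof.
move=> nk pA minA.
have [K K0 HK] := @lattice_sum_bump R n A 2 isT pA.
have d0 : 0 < Num.sqrt (ratr (\det A)) :> R by rewrite sqrtr_gt0 ltr0q posdef_det.
have f0 : 0 < k.+1`!%:R :> R by rewrite ltr0n fact_gt0.
rewrite -ler_pdivrMl // -[leRHS]mul1r -ler_pdivrMr //.
set c := _ / _.
(* The lower and upper bounds are compared at mesh [1 / M] with [s = 0]; the even exponent [2 + n]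
   removes the square root. *)
have Hc (M : nat) : (0 < M)%N -> K / M%:R < 1 -> c * (1 - K / M%:R) ^+ k.+1 <= 1.
  move=> M0 KM; have m0 : 0 < M%:R^-1 :> R by rewrite invr_gt0 ltr0n.
  have [Z uZ] := HK M%:R^-1 0 m0 (lexx 0).
  rewrite add0r; under [leRHS]eq_bigr do rewrite add0r.
  rewrite -mulr_sumr => H.
  have -> : c * (1 - K / M%:R) ^+ k.+1 = \prod_(i < n) wallis R (3 + i) /
     Num.sqrt (ratr (\det A)) * bump (2 + n) (M%:R^-1 * K).
    have -> : \prod_(i < n) wallis R (3 + i) = pi ^+ k / k.+1`!%:R.
      by rewrite nk prod_wallis.
    have -> : (2 + n = 2 * k.+1)%N by rewrite nk mul2n doubleS.
    rewrite /bump exprM sqr_sqrtr.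
      by rewrite /c [K / _]mulrC; ring.
    by rewrite subr_ge0 mulrC ltW.
  apply: le_trans H _.
  apply: le_trans (ler_wpM2l _ (lattice_sum_le pA M0 minA uZ)) _.
    by rewrite exprn_ge0 // ltW.
  by rewrite -exprMn mulVf ?expr1n // pnatr_eq0 -lt0n.
clearbody c; rewrite leNgt; apply/negP => c1.
have c0 : 0 < c by lra.
have Y0 : 0 <= c * k.+1%:R * K / (c - 1).
  by rewrite divr_ge0 ?subr_ge0 ?(ltW c1) // !mulr_ge0 // ltW.
(* The second summand makes Bernoulli's lower bound [c (1 - (k + 1) K / M)] exceed [1] for [M > X];
   the first ensures [K / M < 1]. *)
pose X := K + c * k.+1%:R * K / (c - 1).
have X0 : 0 <= X by rewrite addr_ge0.
pose M := Num.bound X.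
have MX : X < M%:R by apply: archi_boundP.
have M0 : 0 < M%:R :> R by apply: le_lt_trans MX.
have KX : c * k.+1%:R * K / (c - 1) <= X by rewrite /X; lra.
have KM : K / M%:R < 1.
  rewrite ltr_pdivrMr // mul1r; apply: le_lt_trans MX.
  by rewrite /X lerDl.
have := Hc M ltac:(by rewrite -(ltr0n R)) KM.
have bern m (t : R) : 0 <= t -> t <= 1 -> 1 - m%:R * t <= (1 - t) ^+ m.
  move=> t0 t1; elim: m => [|m IH]; first by rewrite mul0r subr0 expr0.
  rewrite exprS -natr1; have m0 : 0 <= m%:R :> R by rewrite ler0n.
  have : (1 - t) * (1 - m%:R * t) <= (1 - t) * (1 - t) ^+ m.
    by rewrite ler_wpM2l // subr_ge0.
  have : 0 <= m%:R * (t * t) by rewrite !mulr_ge0.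
  move: ((1 - t) ^+ m) => y; nra.
have tK : 0 <= K / M%:R by rewrite divr_ge0 // ltW.
have := bern k.+1 (K / M%:R) tK (ltW KM).
rewrite -(ler_pM2l c0) => h1 h2; have := le_trans h1 h2.
apply/negP; rewrite -ltNge mulrBr mulr1 ltrBrDl -ltrBrDr.
have -> : c * (k.+1%:R * (K / M%:R)) = c * k.+1%:R * K / M%:R by ring.
rewrite ltr_pdivrMr // -ltr_pdivrMl ?subr_gt0 // mulrC.
exact: le_lt_trans MX.
Qed.

End Packing.

(** * Numerical estimates *)

Section Numerics.
Variable R : realType.

Lemma sin_le_id (x : R) : 0 <= x -> sin x <= x.
Proof.
move=> x0; pose f : R -> R := sin - id.
have df (t : R) : is_derive t (1 : R) f (cos t - 1).
  exact: is_deriveB (is_derive_sin t) (is_derive_id t (1 : R)).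
suff : f x <= f 0 by rewrite /f /= !fctE sin0; lra.
apply: (@ler0_derive1_le_cc R f 0 x) => //; rewrite ?in_itv /= ?lexx ?x0 //.
- by move=> u _; rewrite derive1E; have [_ ->] := df u; rewrite subr_le0 cos_le1.
apply: continuous_subspaceT => u.
by apply: differentiable_continuous; apply/derivable1_diffP; have := df u; case.
Qed.

(* [sin (pi / 16) <= pi / 16], the sine being computed by halving angles. *)
Lemma pi_gt_31_10 : 31 / 10 < pi :> R.
Proof.
have p0 := pi_gt0 R.
have c4 : 0 < cos (pi / 4) :> R by apply: cos_gt0_pihalf; lra.
have c8 : 0 < cos (pi / 8) :> R by apply: cos_gt0_pihalf; lra.
have := cos_mulr2n (pi / 4 : R); have := cos_mulr2n (pi / 8 : R).
have := cos_mulr2n (pi / 16 : R).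
have -> : (pi / 16) *+ 2 = pi / 8 :> R by rewrite -mulr_natr; field.
have -> : (pi / 8) *+ 2 = pi / 4 :> R by rewrite -mulr_natr; field.
have -> : (pi / 4) *+ 2 = pi / 2 :> R by rewrite -mulr_natr; field.
rewrite cos_pihalf !mulr2n (cos2sin2 (pi / 16)).
have := @sin_le_id (pi / 16) ltac:(lra).
have : 0 <= sin (pi / 16) :> R by apply: sin_ge0_pi; lra.
move: (sin (pi / 16)) (cos (pi / 8)) (cos (pi / 4)) c8 c4 => s c d.
move=> c8 c4 s0 sle Ec Ed E0.
(* Slight rational overestimates of [cos (pi / 4)] and [cos (pi / 8)]; they force
   [2 s ^ 2 >= 19 / 250], hence [s > 31 / 160]. *)
have d1 : d <= 442 / 625 by nra.
have d2 : c <= 231 / 250 by nra.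
nra.
Qed.

(** The binomial expansion cut after degree four; at [k = 20] the truncation is about [2.648], and
    it grows with [k]. *)
Lemma expr1DV_ge (k : nat) : (20 <= k)%N -> 1323 / 500 <= (1 + k%:R^-1 : R) ^+ k.
Proof.
move=> k20; have k0 : 20 <= k%:R :> R by rewrite (ler_nat R 20).
have bin n (x : R) : 0 <= x ->
   1 + n%:R * x + n%:R * (n%:R - 1) / 2 * x ^+ 2
   + n%:R * (n%:R - 1) * (n%:R - 2) / 6 * x ^+ 3
   + n%:R * (n%:R - 1) * (n%:R - 2) * (n%:R - 3) / 24 * x ^+ 4 <= (1 + x) ^+ n.
  move=> x0; elim: n => [|n IH]; first by rewrite expr0; lra.
  rewrite [(1 + x) ^+ n.+1]exprS.
  have x1 : 0 <= 1 + x by lra.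
  apply: le_trans (ler_wpM2l x1 IH); rewrite -natr1.
  have c5 : 0 <= n%:R * (n%:R - 1) * (n%:R - 2) * (n%:R - 3) :> R.
    case: n {IH} => [|[|[|n]]]; [lra|lra|lra|].
    rewrite -!natr1; have : 0 <= n%:R :> R by [].
    move: (n%:R : R) => y y0.
    by rewrite !mulr_ge0 //; lra.
  have : 0 <= n%:R * (n%:R - 1) * (n%:R - 2) * (n%:R - 3) / 24 * (x ^+ 5).
    by rewrite mulr_ge0 ?exprn_ge0 // divr_ge0.
  move: (n%:R : R) => y; lra.
have := bin k k%:R^-1 ltac:(by rewrite invr_ge0).
apply: le_trans.
set x := k%:R^-1; have x0 : 0 < x by rewrite invr_gt0; lra.
have kx : k%:R * x = 1 by rewrite mulfV // gt_eqF //; lra.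
have x20 : x <= 1 / 20 by nra.
have -> : 1 + k%:R * x + k%:R * (k%:R - 1) / 2 * x ^+ 2 +
  k%:R * (k%:R - 1) * (k%:R - 2) / 6 * x ^+ 3 +
  k%:R * (k%:R - 1) * (k%:R - 2) * (k%:R - 3) / 24 * x ^+ 4 =
  2 + (1 - x) / 2 + (1 - x) * (1 - 2 * x) / 6 + (1 - x) * (1 - 2 * x) * (1 - 3 * x) / 24.
  by rewrite /x; field; rewrite gt_eqF //; lra.
nra.
Qed.

(** Small [n] are computed. Beyond them, with [k = n + 6], passing to [n + 1] multiplies the left
    side by [k - 4] and the right side by [31 / 80 (k + 1) (1 + 1 / k) ^ n]. *)
Lemma fact_ltr_expr n : (0 < n)%N ->
  n.+1`!%:R < (31 / 10 * ((n + 6)%:R / 8)) ^+ n :> R.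
Proof.
move=> n0.
have [n14|n14] := leqP n 14.
  do 15 (case: n n0 n14 => [|n] n0 n14;
    [by [] || (rewrite !factS fact0 !natrM; lra) | ]).
  by rewrite !ltnS ltn0 in n14.
elim: n n14 {n0} => // n IH.
rewrite ltnS leq_eqVlt => /orP[/eqP <-|n14].
  by rewrite !factS fact0 !natrM; lra.
have {IH} := IH n14.
have := @expr1DV_ge (n + 6) ltac:(by rewrite -[20%N]/(14 + 6)%N leq_add2r ltnW).
rewrite [n.+2`!]factS natrM addSn.
have -> : (n + 6).+1%:R = (n + 6)%:R + 1 :> R by rewrite natr1.
have k20 : 20 <= (n + 6)%:R :> R.
  by rewrite (ler_nat R 20) -[20%N]/(14 + 6)%N leq_add2r ltnW.
have -> : n.+2%:R = (n + 6)%:R - 4 :> R by rewrite -!natr1 natrD; lra.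
have k0 : (n + 6)%:R != 0 :> R by rewrite gt_eqF //; lra.
have -> : 31 / 10 * (((n + 6)%:R + 1) / 8) =
    31 / 10 * ((n + 6)%:R / 8) * (1 + (n + 6)%:R^-1) :> R by field.
rewrite [(_ * _) ^+ n.+1]exprMn [(1 + _) ^+ (n + 6)]exprD ![_ ^+ n.+1]exprSr.
move: k20 k0; set k := (n + 6)%:R; set P := (_ * _) ^+ n; set E := (1 + _) ^+ n.
clearbody k P E => k20 k0 hE hP.
have k1 : 0 < k + 1 by lra.
have kE : 1 + k^-1 = (k + 1) / k by field.
(* The estimate [hE] has exponent [k = n + 6]; its six surplus factors are cleared of
   denominators. *)
have E1 : 1323 / 500 * k ^+ 6 <= E * (k + 1) ^+ 6.
  by move: hE; rewrite kE expr_div_n mulrA ler_pdivlMr // exprn_gt0 //; lra.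
have P0 : 0 <= n.+1`!%:R :> R by [].
(* [31/80 * 1323/500 > 41/40], and [k^2/40 - k + 10 = (k - 20)^2/40] absorbs the
   two leading terms of the difference. *)
have main : (k - 4) * (k + 1) ^+ 5 <= 31 / 80 * (1323 / 500) * k ^+ 6.
  have : 0 <= (k - 20) ^+ 2 * k ^+ 4 by rewrite mulr_ge0 ?sqr_ge0 ?exprn_ge0 //; lra.
  have : 0 <= k ^+ 3 by rewrite exprn_ge0 //; lra.
  have : 0 <= k ^+ 2 by rewrite exprn_ge0 //; lra.
  have : 0 <= k ^+ 6 by rewrite exprn_ge0 //; lra.
  move: k20; lra.
have step : k - 4 <= 31 / 80 * (k + 1) * E.
  rewrite -(@ler_pM2r _ ((k + 1) ^+ 5)) ?exprn_gt0 //.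
  apply: le_trans main _; lra.
rewrite kE.
have -> : P * (31 / 10 * (k / 8)) * (E * ((k + 1) / k)) =
   P * (31 / 80 * (k + 1) * E) by field.
have P1 : 0 < P by lra.
apply: lt_le_trans (_ : (k - 4) * P <= _); first by rewrite ltr_pM2l //; lra.
by rewrite mulrC ler_pM2l.
Qed.

End Numerics.

(** * Forms of level two *)

Local Open Scope sesquilinear_scope.

(** Unitary diagonalization: in the coordinates [w = P y] the form is a sum of [|w_i|^2] weighted by
    eigenvalues, the rows of [P] being eigenvectors. *)
Lemma hermitian_pos_eigen n (B : 'M[algC]_n) (y : 'cV[algC]_n) :
  B \is hermsymmx -> (forall a, eigenvalue B a -> 0 < a) -> y != 0 ->
  0 < (y^t* *m B *m y) 0 0.
Proof.
move=> hermB posB y0.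
have /orthomx_spectralP BE := hermitian_normalmx hermB.
set P := spectralmx B in BE; set D := spectral_diag B in BE.
have Pu : P \in unitmx := spectral_unit B.
have PB : P *m B = diag_mx D *m P by rewrite BE !mulmxA mulmxV // mul1mx.
have D0 i : 0 < D 0 i.
  apply: posB; apply/eigenvalueP; exists (row i P).
    by rewrite -row_mul PB row_mul row_diag_mx -scalemxAl -rowE.
  apply: contraTneq Pu => ri; rewrite -row_free_unit; apply/negP => Pf.
  have := row_freeP Pf => -[Q PQ].
  have := congr1 (row i) PQ; rewrite row_mul ri mul0mx => /matrixP/(_ 0 i).
  by rewrite !mxE eqxx => /eqP; rewrite eq_sym oner_eq0.
pose w := P *m y.
have w0 : w != 0.
  by apply: contraNneq y0 => w0; rewrite -[y](mulKmx Pu) -/w w0 mulmx0.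
have -> : (y^t* *m B *m y) 0 0 = \sum_i D 0 i * `|w i 0| ^+ 2.
  rewrite {1}BE (invmx_unitary (spectral_unitarymx B)) -/P !mulmxA -mulmxA -/w.
  have -> : y^t* *m P^t* = w^t* by rewrite /w trmx_mul map_mxM.
  rewrite mxE; apply: eq_bigr => i _.
  by rewrite mul_mx_diag !mxE normCK; ring.
have [i wi] : exists i, w i 0 != 0.
  apply/existsP; apply: contraNT w0; rewrite negb_exists => /forallP H.
  apply/eqP/matrixP => i j; rewrite (ord1 j); apply/eqP.
  by have := H i; rewrite negbK => /eqP ->; rewrite mxE.
rewrite (bigD1 i) //= ltr_wpDr ?sumr_ge0 // => [j _|].
  by rewrite mulr_ge0 ?exprn_ge0 // ltW.
by rewrite mulr_gt0 // exprn_gt0 // normr_gt0.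
Qed.

Lemma posdef_of_form v (A : 'M[int]_v) : even_pos_def_form A -> posdef (mx_rat A).
Proof.
move=> [symA [_ eigA]].
split=> [|x x0]; first by rewrite /mx_rat map_trmx symA.
pose B := mx_algC A; pose y : 'cV[algC]_v := map_mx ratr x.
have BE : B = map_mx ratr (mx_rat A).
  by apply/matrixP => i j; rewrite !mxE ratr_int.
have yE : y^T = y^t*.
  by apply/matrixP => i j; rewrite !mxE; apply/esym/CrealP; rewrite Creal_Crat ?Crat_rat.
have hermB : B \is hermsymmx.
  apply/is_hermitianmxP; rewrite expr0 scale1r; apply/matrixP => i j.
  rewrite !mxE -[in RHS]symA mxE; apply/esym/CrealP.
  by rewrite Rreal_int ?intr_int.
have qE : ratr (qform (mx_rat A) x) = (y^t* *m B *m y) 0 0 :> algC.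
  by rewrite -yE BE /y /qform map_trmx -!map_mxM [in RHS]mxE.
rewrite -(ltr0q algC) qE hermitian_pos_eigen //.
apply: contraNneq x0 => y0; apply/eqP/matrixP => i j.
have := congr1 (fun M : 'cV[algC]_v => M i j) y0; rewrite !mxE => /eqP.
by rewrite fmorph_eq0 => /eqP.
Qed.

(** The matrix [2 A^-1] is integral, so its determinant [2 ^ v / det A] is a positive integer. *)
Lemma det_level2 v (A : 'M[int]_v) : even_pos_def_form A -> is_level A 2 ->
  \det (mx_rat A) <= 2 ^+ v.
Proof.
move=> formA [_ [[intB _] _]].
have d0 := posdef_det (posdef_of_form formA).
set B := _ *: _ in intB.
have BA : \det B * \det (mx_rat A) = 2 ^+ v.
  rewrite -det_mulmx /B -scalemxAl mulVmx ?unitmxE ?unitfE ?gt_eqF //.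
  by rewrite detZ det1 mulr1.
have [z zE] : exists z : int, \det B = z%:~R.
  pose C : 'M[int]_v := map_mx Num.floor B.
  exists (\det C); rewrite -det_map_mx; congr (\det _).
  by apply/matrixP => i j; rewrite [RHS]mxE [C i j]mxE /= floorK ?intB.
have B1 : 1 <= \det B.
  have : 0 < \det B by rewrite -(pmulr_lgt0 _ d0) BA exprn_gt0.
  by rewrite zE ltr0z ler1z.
by rewrite -BA ler_peMl // ltW.
Qed.

(** Off-diagonal terms pair up by symmetry, and diagonal terms carry an even entry. *)
Lemma QA_even v (A : 'M[int]_v) (x : 'cV[int]_v) :
  A^T = A -> (forall i, (2 %| A i i)%Z) -> (2 %| QA A x)%Z.
Proof.
move=> symA evA; pose f i j := x i ord0 * A i j * x j ord0.
have symf i j : f i j = f j i.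
  rewrite /f -{1}symA mxE; ring.
have -> : QA A x = \sum_j \sum_i f i j.
  rewrite /QA mxE; apply: eq_bigr => j _; rewrite mxE mulr_suml.
  by apply: eq_bigr => i _; rewrite !mxE.
have -> : \sum_j \sum_i f i j =
   2 * (\sum_(j < v) \sum_(i < v | (i < j)%N) f i j) + \sum_j f j j.
  have -> : \sum_j \sum_i f i j = \sum_(j < v) (\sum_(i < v | (i < j)%N) f i j +
      (f j j + \sum_(i < v | (j < i)%N) f i j)).
    apply: eq_bigr => j _; rewrite (bigID (fun i : 'I_v => (i < j)%N)) /=.
    congr (_ + _); rewrite (bigD1 j) ?ltnn //=; congr (_ + _).
    by apply: eq_bigl => i; rewrite -leqNgt ltn_neqAle andbC eq_sym.
  rewrite !big_split /=.
  have -> : \sum_(j < v) \sum_(i < v | (j < i)%N) f i j =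
     \sum_(j < v) \sum_(i < v | (i < j)%N) f i j.
    rewrite (exchange_big_dep xpredT) //=; apply: eq_bigr => j _.
    by apply: eq_bigr => i _; exact: symf.
  ring.
rewrite rpredD ?dvdz_mulr //.
apply: rpred_sum => i _.
by rewrite /f dvdz_mulr // dvdz_mull.
Qed.

Lemma qform_mx_rat v (A : 'M[int]_v) x : qform (mx_rat A) (intvec x) = (QA A x)%:~R.
Proof. by rewrite /qform /intvec /mx_rat map_trmx -!map_mxM mxE. Qed.

(** Covers both residue classes: [v = 8m] and [v = 8m + 4] give [k = 4m] and [k = 4m + 2], with the
    same bound [2m + 2]. Otherwise evenness pushes the minimum up to [2m + 4], against
    [blichfeldt]. *)
Lemma short_vector v (A : 'M[int]_v) k m :
  even_pos_def_form A -> is_level A 2 -> v = k.*2 -> (0 < k <= 4 * m + 2)%N ->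
  exists2 x, 0 < QA A x & QA A x <= (2 * m + 2)%N.
Proof.
move=> formA levA vk /andP[k0 km].
have pA := posdef_of_form formA.
apply: contrapT => noshort.
have minA z : z != 0 -> (2 * m + 4)%:R <= qform (mx_rat A) (intvec z).
  move=> z0.
  have := pA.2 (intvec z); rewrite qform_mx_rat ltr0z => q0.
  have {}q0 : 0 < QA A z.
    apply: q0; apply: contraNneq z0 => /matrixP E; apply/eqP/matrixP => i j.
    by have := E i j; rewrite !mxE => /eqP; rewrite intr_eq0 => /eqP.
  have /dvdzP [t tE] := QA_even z formA.1 formA.2.1.
  have : ~ (QA A z <= (2 * m + 2)%N) by move=> ?; apply: noshort; exists z.
  have -> : (2 * m + 4)%:R = (2 * m + 4)%N%:Z%:~R :> rat by [].
  rewrite ler_int; lia.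
(* Scaling by [a] brings the minimum from [2m + 4] down to the [2] assumed in [blichfeldt]; the root
   of the determinant gains [a ^ k]. *)
pose a : rat := (m + 2)%:R^-1.
have a0 : 0 < a by rewrite invr_gt0 ltr0n addn2.
have qa x : qform (a *: mx_rat A) x = a * qform (mx_rat A) x.
  by rewrite /qform -scalemxAr -scalemxAl mxE.
have pB : posdef (a *: mx_rat A).
  split=> [|x x0]; first by rewrite linearZ /= pA.1.
  by rewrite qa mulr_gt0 // pA.2.
have := @blichfeldt Rdefinitions.R v k _ vk pB.
have minB z : z != 0 -> 2 <= qform (a *: mx_rat A) (intvec z).
  move=> z0; rewrite qa ler_pdivlMl ?ltr0n ?addn2 //.
  by apply: le_trans (minA z z0); rewrite -natrM ler_nat; lia.
move=> /(_ minB).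
apply/negP; rewrite -ltNge.
have dB : Num.sqrt (ratr (\det (a *: mx_rat A))) <= (2 / (m + 2)%:R) ^+ k :> Rdefinitions.R.
  rewrite -[leRHS]ger0_norm ?exprn_ge0 ?divr_ge0 // -sqrtr_sqr ler_wsqrtr //.
  rewrite -exprM muln2 -vk.
  have -> : (2 / (m + 2)%:R) ^+ v = ratr (a ^+ v * 2 ^+ v) :> Rdefinitions.R.
    by rewrite -exprMn rmorphXn rmorphM fmorphV !rmorph_nat mulrC.
  by rewrite ler_rat detZ ler_pM2l ?exprn_gt0 // det_level2.
have f0 : 0 < k.+1`!%:R :> Rdefinitions.R by rewrite ltr0n fact_gt0.
apply: le_lt_trans (_ : k.+1`!%:R * (2 / (m + 2)%:R) ^+ k < _).
  by rewrite ler_pM2l.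
have m0 : 0 < (m + 2)%:R :> Rdefinitions.R by rewrite ltr0n addn2.
rewrite -ltr_pdivlMr ?exprn_gt0 ?divr_gt0 //.
apply: lt_le_trans (@fact_ltr_expr _ k k0) _.
(* The bases are compared: [31 / 10 < pi], and [(k + 6) / 8 <= (m + 2) / 2] because
   [k <= 4m + 2]. *)
rewrite -expr_div_n lerXn2r ?nnegrE ?divr_ge0 ?mulr_ge0 ?pi_ge0 //.
rewrite invf_div ler_pM ?divr_ge0 ?(ltW (pi_gt_31_10 _)) //.
rewrite ler_pdivrMr // mulrAC ler_pdivlMr //.
by rewrite -!natrM ler_nat; lia.
Qed.

Theorem theorem3p1 (v : nat) (A : 'M[int]_v) :
  even_pos_def_form A -> is_level A 2 ->
  ((8 %| v)%N ->
     exists (n : nat) (x : 'cV[int]_v),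
       (0 < n)%N /\ (2 * n)%:R <= 2 + (v%:R / 4 : rat) /\ QA A x = (2 * n)%:Z) /\
  ((v %% 8 = 4)%N ->
     exists (n : nat) (x : 'cV[int]_v),
       (0 < n)%N /\ (2 * n)%:R <= 1 + (v%:R / 4 : rat) /\ QA A x = (2 * n)%:Z).
Proof.
move=> formA levA.
(* In dimension [0] the integrality condition holds vacuously for [1], so the level cannot be
   two. *)
have v0 : (0 < v)%N.
  case: v A formA levA => // A _ [_ [_ /(_ 1%N isT isT)]] []; split=> -[] //.
have conclude k m : v = k.*2 -> (0 < k <= 4 * m + 2)%N ->
  exists (n : nat) (x : 'cV[int]_v),
    (0 < n)%N /\ (2 * n <= 2 * m + 2)%N /\ QA A x = (2 * n)%:Z.
  move=> vk km; have [x q0 qm] := short_vector formA levA vk km.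
  have /dvdzP [t tE] := QA_even x formA.1 formA.2.1.
  exists `|t|%N, x; lia.
split=> hv.
  have [m vm] : exists m, v = (8 * m)%N by exists (v %/ 8)%N; rewrite mulnC divnK.
  have [||n [x [n0 [nm Qx]]]] := conclude (4 * m)%N m; try lia.
  exists n, x; split=> //; split=> //.
  have -> : 2 + v%:R / 4 = (2 * m + 2)%:R :> rat.
    by rewrite vm [(8 * m)%:R]natrM [(2 * m + 2)%:R]natrD natrM; lra.
  by rewrite ler_nat.
have [m vm] : exists m, v = (8 * m + 4)%N.
  by exists (v %/ 8)%N; rewrite {1}(divn_eq v 8) hv mulnC.
have [||n [x [n0 [nm Qx]]]] := conclude (4 * m + 2)%N m; try lia.
exists n, x; split=> //; split=> //.
have -> : 1 + v%:R / 4 = (2 * m + 2)%:R :> rat.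
  by rewrite vm [(8 * m + 4)%:R]natrD [(2 * m + 2)%:R]natrD !natrM; lra.
by rewrite ler_nat.
Qed.
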